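(* Suppose $\pi=\alpha_1|\ldots|\alpha_k$ is a nonempty permutation, where $\alpha_1,\ldots,\alpha_k$ are complete. Then $$F_\pi(x) = 1 + x F_\beta(x) + x^2 \sum_{i=1}^k \left( F_{\overline{\alpha_1|\ldots|\alpha_i}}(x) - F_{\overline{\alpha_1|\ldots|\alpha_{i-1}}}(x)\right) F_{\alpha_i|\ldots|\alpha_k}(x).$$ Here $\beta=\pi$ if $\alpha_1\neq 1$ and $\beta=\alpha_2|\ldots|\alpha_k$ if $\alpha_1=1$.
   Context: Permutations are written in one-line notation. A permutation $\pi$ avoids $\sigma$ if no subsequence of $\pi$ has the same relative order as $\sigma$. For a permutation $\sigma$, $I_n(3412,\sigma)$ is the set of involutions of $\{1,\ldots,n\}$ which avoid $3412$ and $\sigma$, and $F_\sigma(x)=\sum_{n\ge 0}|I_n(3412,\sigma)|x^n$. Every permutation contains the empty permutation $\emptyset$, so $F_\emptyset(x)=0$. $|\pi|$ is the length of $\pi$; for a sequence $\sigma$ of integers, $\sigma^{+n}$ is obtained by adding $n$ to each entry. A permutation $\pi$ of $\{1,\ldots,n\}$, $n\ge1$, is complete if no initial segment of $\pi$ of length $k$ with $1\le k<n$ consists of the numbers $1,2,\ldots,k$. The notation $\alpha_1|\alpha_2|\ldots|\alpha_k$ means the permutation $\alpha_1\,\alpha_2^{+|\alpha_1|}\,\alpha_3^{+|\alpha_1|+|\alpha_2|}\cdots\alpha_k^{+|\alpha_1|+\cdots+|\alpha_{k-1}|}$ (the empty permutation if there are no factors); every permutation is uniquely of this form with all $\alpha_i$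 complete. For a permutation $\pi$, $\overline{\pi}$ is defined by: (1) $\overline{\emptyset}=\overline{1}=\emptyset$; (2) if $|\pi|\ge2$ and $\pi=|\pi|\,\sigma^{+1}\,1$ for a permutation $\sigma$, then $\overline{\pi}=\sigma$; (3) if $|\pi|\ge2$ and $\pi=|\pi|\,\sigma$ for a permutation $\sigma$ which does not end with $1$, then $\overline{\pi}=\sigma$; (4) if $|\pi|\ge2$, $\pi=\sigma^{+1}\,1$ for a permutation $\sigma$, and $\pi$ does not begin with $|\pi|$, then $\overline{\pi}=\sigma$; (5) if $|\pi|\ge2$, $\pi$ does not begin with $|\pi|$ and does not end with $1$, then $\overline{\pi}=\pi$. *)

(* Defs.v *)
From HB Require Import structures.
From mathcomp Require Import all_boot all_order all_fingroup all_algebra.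
From mathcomp Require Import boolp.

Set Implicit Arguments.
Unset Strict Implicit.
Unset Printing Implicit Defensive.

Import GRing.Theory.

(* Formal power series over the integers; coef f n is the coefficient of x^n. *)
Record fps := Fps { coef : nat -> int }.

HB.instance Definition _ := gen_eqMixin fps.
HB.instance Definition _ := gen_choiceMixin fps.

Lemma fpsP (f g : fps) : coef f =1 coef g <-> f = g.
Proof.
by split=> [|->] //; case: f g => [f] [g] /= /funext ->.
Qed.

Section FpsRing.
Local Open Scope ring_scope.

Definition fps_zero := Fps (fun=> 0).
Definition fps_one := Fps (fun n => (n == 0%N)%:R).
Definition fps_opp f := Fps (fun n => - coef f n).
Definition fps_add f g := Fps (fun n => coef f n + coef g n).
Definition fps_mul f g :=
  Fps (fun n => \sum_(j < n.+1) coef f j * coef g (n - j)%N).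

Fact fps_addA : associative fps_add.
Proof. by move=> f g h; apply/fpsP => n /=; rewrite addrA. Qed.

Fact fps_addC : commutative fps_add.
Proof. by move=> f g; apply/fpsP => n /=; rewrite addrC. Qed.

Fact fps_add0 : left_id fps_zero fps_add.
Proof. by move=> f; apply/fpsP => n /=; rewrite add0r. Qed.

Fact fps_addN : left_inverse fps_zero fps_opp fps_add.
Proof. by move=> f; apply/fpsP => n /=; rewrite addNr. Qed.

HB.instance Definition _ :=
  GRing.isZmodule.Build fps fps_addA fps_addC fps_add0 fps_addN.

Fact fps_mulE f g n :
  coef (fps_mul f g) n = \sum_(j < n.+1) coef f j * coef g (n - j)%N.
Proof. by []. Qed.

Fact fps_mul_rev f g n :
  coef (fps_mul f g) n = \sum_(j < n.+1) coef f (n - j)%N * coef g j.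
Proof.
rewrite /= (reindex_inj rev_ord_inj) /=.
by apply: eq_bigr => j _; rewrite (sub_ordK j).
Qed.

Fact fps_mulA : associative fps_mul.
Proof.
move=> p q r; apply/fpsP => i; rewrite fps_mulE fps_mul_rev.
pose coef3 j k := coef p j * (coef q (i - j - k)%N * coef r k).
transitivity (\sum_(j < i.+1) \sum_(k < i.+1 | (k <= i - j)%N) coef3 j k).
  apply: eq_bigr => j _; rewrite fps_mul_rev.
  by rewrite big_distrr /= (big_ord_narrow_leq (leq_subr _ _)).
rewrite (exchange_big_dep predT) //=; apply: eq_bigr => k _.
transitivity (\sum_(j < i.+1 | (j <= i - k)%N) coef3 j k).
  apply: eq_bigl => j; rewrite -ltnS -(ltnS j) -!subSn ?leq_ord //.
  by rewrite -subn_gt0 -(subn_gt0 j) -!subnDA addnC.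
rewrite (big_ord_narrow_leq (leq_subr _ _)) big_distrl /=.
by apply: eq_bigr => j _; rewrite /coef3 -!subnDA addnC mulrA.
Qed.

Fact fps_mulC : commutative fps_mul.
Proof.
move=> f g; apply/fpsP => n; rewrite fps_mul_rev.
by apply: eq_bigr => j _; rewrite mulrC.
Qed.

Fact fps_mul1 : left_id fps_one fps_mul.
Proof.
move=> f; apply/fpsP => n; rewrite /= big_ord_recl /= subn0 mul1r.
by rewrite big1 ?addr0 // => j _; rewrite mul0r.
Qed.

Fact fps_mulDl : left_distributive fps_mul fps_add.
Proof.
move=> f g h; apply/fpsP => n /=; rewrite -big_split /=.
by apply: eq_bigr => j _; rewrite mulrDl.
Qed.

Fact fps_one_neq0 : fps_one != fps_zero.
Proof. by apply/eqP => /fpsP /(_ 0). Qed.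

HB.instance Definition _ := GRing.Zmodule_isComNzRing.Build fps
  fps_mulA fps_mulC fps_mul1 fps_mulDl fps_one_neq0.

Definition fpsX : fps := Fps (fun n => (n == 1%N)%:R).

Lemma coefD (f g : fps) n : coef (f + g) n = coef f n + coef g n.
Proof. by []. Qed.

Lemma coefM (f g : fps) n :
  coef (f * g) n = \sum_(j < n.+1) coef f j * coef g (n - j)%N.
Proof. by []. Qed.

End FpsRing.

Notation "''x'" := fpsX (at level 0) : ring_scope.

(* A permutation of {1, ..., n} in one-line notation is the word of length n
   of its values; this lets patterns of different lengths live in one type. *)

Definition is_perm (pi : seq nat) : bool := perm_eq pi (iota 1 (size pi)).

Definition same_order (t p : seq nat) : bool :=
  (size t == size p) &&
  [forall i : 'I_(size p), forall j : 'I_(size p),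
     (nth 0 t i < nth 0 t j) == (nth 0 p i < nth 0 p j)].

Definition contains (w p : seq nat) : bool :=
  [exists m : (size w).-tuple bool, same_order (mask m w) p].

Definition avoids (w p : seq nat) : bool := ~~ contains w p.

Lemma containsP w p :
  reflect (exists2 t, subseq t w & same_order t p) (contains w p).
Proof.
apply: (iffP existsP) => [[m wp] | [t /subseqP[m sz_m ->] wp]].
  by exists (mask m w); rewrite ?mask_subseq.
by move/eqP in sz_m; exists (Tuple sz_m).
Qed.

(* 'I_n is {0, ..., n-1}, hence the successor. *)
Definition one_line n (s : 'S_n) : seq nat := [seq (s i).+1 | i <- enum 'I_n].

Definition I3412 (n : nat) (sigma : seq nat) : {set 'S_n} :=
  [set s : 'S_n | [&& (s * s == 1)%g,
                      avoids (one_line s) [:: 3; 4; 1; 2]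
                    & avoids (one_line s) sigma]].

Definition F (sigma : seq nat) : fps := Fps (fun n => Posz #|I3412 n sigma|).

Definition shift (n : nat) (s : seq nat) : seq nat := [seq a + n | a <- s].

Definition complete (pi : seq nat) : bool :=
  [&& is_perm pi, 0 < size pi &
      [forall k : 'I_(size pi), (0 < k) ==> ~~ perm_eq (take k pi) (iota 1 k)]].

Fixpoint bars_from (n : nat) (alpha : seq (seq nat)) : seq nat :=
  if alpha is a :: alpha' then shift n a ++ bars_from (n + size a) alpha'
  else [::].

(* alpha_1 | ... | alpha_k *)
Definition bars (alpha : seq (seq nat)) : seq nat := bars_from 0 alpha.

(* For a permutation pi, the word left after deleting a leading |pi| or a
   trailing 1 is a permutation, up to the shift when 1 is deleted; see the
   lemmas overline_rule* below. *)
Definition overline (pi : seq nat) : seq nat :=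
  if size pi <= 1 then [::] else
  match head 0 pi == size pi, last 0 pi == 1 with
  | true, true => map predn (behead (take (size pi).-1 pi))
  | true, false => behead pi
  | false, true => map predn (take (size pi).-1 pi)
  | false, false => pi
  end.

Lemma shift1K : cancel (shift 1) (map predn).
Proof. by move=> s; rewrite -map_comp map_id_in // => a _ /=; rewrite addn1. Qed.

Lemma overline_rule1 : overline [::] = [::] /\ overline [:: 1] = [::].
Proof. by []. Qed.

Lemma overline_rule2 sigma pi : pi = (size pi) :: rcons (shift 1 sigma) 1 ->
  overline pi = sigma.
Proof.
move=> pi_eq; have sz : size pi = (size sigma).+2.
  by rewrite pi_eq /= size_rcons size_map.
rewrite /overline sz {1 2 3}pi_eq /= sz eqxx last_rcons eqxx.
by rewrite -cats1 take_size_cat ?size_map // shift1K.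
Qed.

Lemma overline_rule3 sigma pi : 1 < size pi -> pi = (size pi) :: sigma ->
  last 0 sigma != 1 -> overline pi = sigma.
Proof.
move=> sz pi_eq s1; rewrite /overline leqNgt sz.
have -> : last 0 pi = last 0 sigma.
  by move: sz; rewrite pi_eq; case: (sigma).
by rewrite (negPf s1) [X in head 0 X]pi_eq /= eqxx [X in behead X]pi_eq.
Qed.

Lemma overline_rule4 sigma pi : 1 < size pi -> pi = rcons (shift 1 sigma) 1 ->
  head 0 pi != size pi -> overline pi = sigma.
Proof.
move=> sz pi_eq /negPf hpi; rewrite /overline leqNgt sz hpi /=.
rewrite pi_eq last_rcons eqxx size_rcons /= -cats1 take_size_cat ?shift1K //.
Qed.

Lemma overline_rule5 pi : 1 < size pi ->
  head 0 pi != size pi -> last 0 pi != 1 -> overline pi = pi.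
Proof. by move=> sz /negPf h /negPf l; rewrite /overline leqNgt sz h l. Qed.

(* Main.v *)
Require Import Defs.
From mathcomp Require Import all_boot all_order all_fingroup all_algebra.
From mathcomp Require Import zify.

Set Implicit Arguments.
Unset Strict Implicit.
Unset Printing Implicit Defensive.

(** Call the direct sum of two words u and v the word u followed by v shifted
    above u (dsum u v), and call the cap of t the word which consists of |t|+2,
    t shifted by one, and 1 (cap t).  Two facts about these operations give the
    formula.

    Structure.  Let w be a nonempty involution avoiding 3412 with first value
    j.  No i < j can have w(i) > j, as j w(i) 1 i would be a 3412-pattern;
    hence w maps {1, ..., j} to itself, and w is the direct sum of its first j
    entries and of a shorter involution of the same class.  The first block is
    1 if j = 1, and otherwise it begins with its maximum and, being an
    involution, ends with 1: it is the cap of a member t of the class.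
    Conversely all these sums are in the class (words_succ), because 3412 is
    complete and neither begins with its maximum nor ends with its minimum.

    Containment.  The first entry of a cap can only be the leading maximum of a
    copy of a pattern, its last entry only the trailing minimum, so the cap of t
    avoids p exactly when t avoids the overline of p (contains_cap).  A
    copy of a1|...|ak in the direct sum of u and v is cut into a part in u
    and a part in v, and the cut must fall between two complete factors
    (contains_dsum).  So the sum avoids the pattern exactly when u avoids
    a1|...|ai for some i and, for the first such i, v avoids ai|...|ak.  Since
    avoidance is monotone in i, the indicator that i is this first index is the
    difference of the indicators of u avoiding a1|...|ai and a1|...|a(i-1)
    (avoids_dsum).

    Summing these indicators over the words with a capped first block yields
    the term in x^2, the words with first block 1 yield x times the series of
    beta, and the empty word yields 1. *)

(** * Order isomorphism and containment *)

(** Reading two words of equal size as one word of pairs turns order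
    isomorphism into a relation between all pairs of letters, which splits
    along concatenations. *)
Definition cmp_agree (u v : nat * nat) : bool := (u.1 < v.1) == (u.2 < v.2).

Lemma mem_zip (s t : seq nat) u :
  u \in zip s t -> (u.1 \in s) && (u.2 \in t).
Proof.
elim: s t => [|x s IH] [|y t] //=; rewrite !inE.
case/predU1P=> [->|/IH/andP[-> ->]] /=; first by rewrite !eqxx.
by rewrite !orbT.
Qed.

Lemma same_order_zip t p : same_order t p =
  (size t == size p) && all2rel cmp_agree (zip t p).
Proof.
rewrite /same_order; case: eqP => //= sz.
have szz := size2_zip (eq_leq (esym sz)).
apply/forallP/allrelP => [h u v /(nthP (0, 0))[i]|h i].
  rewrite szz => ip <- /(nthP (0, 0))[j]; rewrite szz => jp <-.
  rewrite !nth_zip //; exact: (forallP (h (Ordinal ip)) (Ordinal jp)).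
apply/forallP => j.
have zi (k : 'I_(size p)) : (nth 0 t k, nth 0 p k) \in zip t p.
  by rewrite -nth_zip // mem_nth // szz.
exact: (h _ _ (zi i) (zi j)).
Qed.

Lemma same_order_cat t1 t2 p1 p2 : size t1 = size p1 ->
  same_order (t1 ++ t2) (p1 ++ p2) =
  [&& same_order t1 p1, same_order t2 p2,
      allrel cmp_agree (zip t1 p1) (zip t2 p2) &
      allrel cmp_agree (zip t2 p2) (zip t1 p1)].
Proof.
move=> sz; rewrite !same_order_zip !size_cat sz eqxx eqn_add2l zip_cat //=.
by rewrite allrel_catl !allrel_catr; do !case: (allrel _ _ _); case: eqP.
Qed.

Lemma same_order_shift n m t p :
  same_order (shift n t) (shift m p) = same_order t p.
Proof.
rewrite !same_order_zip !size_map; congr (_ && _).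
have -> : zip (shift n t) (shift m p) =
    [seq (u.1 + n, u.2 + m) | u <- zip t p].
  by elim: t p => [|a t IH] [|b p] //=; rewrite -IH.
rewrite allrel_mapl allrel_mapr; apply: eq_allrel => u v.
by rewrite /cmp_agree /= !ltn_add2r.
Qed.

Lemma subseq_catP (s s1 s2 : seq nat) :
  reflect (exists2 t, subseq t.1 s1 /\ subseq t.2 s2 & s = t.1 ++ t.2)
          (subseq s (s1 ++ s2)).
Proof.
apply: (iffP idP) => [/subseqP[m sz_m ->]|[[t1 t2] /= [h1 h2] ->]]; last first.
  exact: cat_subseq.
rewrite size_cat in sz_m.
exists (mask (take (size s1) m) s1, mask (drop (size s1) m) s2) => /=.
  by rewrite !mask_subseq.
by rewrite -mask_cat ?cat_take_drop // size_takel // sz_m leq_addr.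
Qed.

Lemma subseq_shiftP n t w :
  reflect (exists2 t', subseq t' w & t = shift n t') (subseq t (shift n w)).
Proof.
apply: (iffP idP) => [/subseqP[m sz_m ->]|[t' h ->]]; last exact: map_subseq.
by exists (mask m w); rewrite ?mask_subseq // /shift map_mask.
Qed.

Lemma contains_shift n m w p : contains (shift n w) (shift m p) = contains w p.
Proof.
apply/containsP/containsP => [[t /subseq_shiftP[t' h ->]]|[t h]].
  by rewrite same_order_shift; exists t'.
by exists (shift n t); rewrite ?same_order_shift // map_subseq.
Qed.

Lemma shift0 s : shift 0 s = s.
Proof. by rewrite /shift (eq_map addn0) map_id. Qed.

Lemma contains_shiftl n w p : contains (shift n w) p = contains w p.
Proof. by rewrite -{1}(shift0 p) contains_shift. Qed.

Lemma contains_shiftr n w p : contains w (shift n p) = contains w p.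
Proof. by rewrite -{1}(shift0 w) contains_shift. Qed.

Lemma contains_nil w : contains w [::].
Proof.
by apply/containsP; exists [::]; rewrite ?sub0seq // same_order_zip.
Qed.

Lemma contains_size w p : contains w p -> size p <= size w.
Proof.
case/containsP=> t /size_subseq le_t; rewrite same_order_zip.
by case/andP=> /eqP <-.
Qed.

Lemma contains1 x y : contains [:: x] [:: y].
Proof.
apply/containsP; exists [:: x]; first exact: subseq_refl.
by rewrite same_order_zip /= /allrel /= /cmp_agree /= !ltnn.
Qed.

Lemma contains_factors w p q :
  contains w (p ++ q) -> contains w p && contains w q.
Proof.
case/containsP=> t tw h.
have sz : size t = size p + size q.
  by rewrite -size_cat; apply/eqP; have /andP[] := h.
move: h; rewrite -{1}(cat_take_drop (size p) t) same_order_cat; last first.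
  by rewrite size_takel // sz leq_addr.
case/and4P=> h1 h2 _ _; apply/andP; split; apply/containsP.
  by exists (take (size p) t) => //; apply: subseq_trans (take_subseq _ _) tw.
by exists (drop (size p) t) => //; apply: subseq_trans (drop_subseq _ _) tw.
Qed.

(** The left word is entirely below (up) or entirely above the right one:
    direct sums need the former, caps the latter. *)
Definition directed (up : bool) : rel nat := if up then ltn else gtn.

(** A copy of p in w1 ++ w2 cuts p in two, and the cut inherits the direction
    between w1 and w2; conversely this direction is what makes copies of the two
    pieces fit together. *)
Lemma contains_cat up w1 w2 p : allrel (directed up) w1 w2 ->
  reflect (exists q, [/\ p = q.1 ++ q.2, allrel (directed up) q.1 q.2,
                         contains w1 q.1 & contains w2 q.2])
          (contains (w1 ++ w2) p).
Proof.
move=> w12; apply: (iffP idP); last first.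
  case=> [[p1 p2] /= [-> p12 /containsP[t1 t1w h1] /containsP[t2 t2w h2]]].
  have t12 : allrel (directed up) t1 t2.
    apply/allrelP => x y /(mem_subseq t1w) xw /(mem_subseq t2w) yw.
    exact: (allrelP w12).
  apply/containsP; exists (t1 ++ t2); first exact: cat_subseq.
  have [/eqP sz1 _] := andP h1.
  rewrite same_order_cat // h1 h2 /=.
  have cross u v : u \in zip t1 p1 -> v \in zip t2 p2 ->
      cmp_agree u v && cmp_agree v u.
    case: u v => [x y] [x' y'] /mem_zip /andP[xt yp] /mem_zip /andP[xt' yp'].
    have := allrelP t12 _ _ xt xt'; have := allrelP p12 _ _ yp yp'.
    by rewrite /cmp_agree /directed; case: (up) => /=; lia.
  apply/andP; split; apply/allrelP => u v hu hv.
    by case/andP: (cross u v hu hv).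
  by case/andP: (cross v u hv hu).
case/containsP=> t /subseq_catP[[t1 t2] /= [t1w t2w] ->] h.
have sz : size t1 + size t2 = size p.
  by have [/eqP] := andP h; rewrite size_cat.
have szt : size t1 = size (take (size t1) p) by rewrite size_takel; lia.
have szd : size t2 = size (drop (size t1) p) by rewrite size_drop; lia.
move: h; rewrite -{1}(cat_take_drop (size t1) p) same_order_cat //.
case/and4P=> h1 h2 /allrelP h12 /allrelP h21.
exists (take (size t1) p, drop (size t1) p); split => /=.
- by rewrite cat_take_drop.
- apply/allrelP => y y'.
  rewrite -(unzip2_zip (eq_leq (esym szt))) => /mapP[u hu ->].
  rewrite -(unzip2_zip (eq_leq (esym szd))) => /mapP[v hv ->].
  have := h12 _ _ hu hv; have := h21 _ _ hv hu.
  case: u v {hu hv} (mem_zip hu) (mem_zip hv) => [x1 y1] [x2 y2].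
  case/andP=> /(mem_subseq t1w) x1w _ /andP[/(mem_subseq t2w) x2w _].
  have := allrelP w12 _ _ x1w x2w.
  by rewrite /cmp_agree /directed; case: (up) => /=; lia.
- by apply/containsP; exists t1.
- by apply/containsP; exists t2.
Qed.

(** * Direct sums and complete factors *)

Definition dsum (u v : seq nat) : seq nat := u ++ shift (size u) v.

Lemma shiftD n m s : shift n (shift m s) = shift (m + n) s.
Proof. by rewrite /shift -map_comp; apply: eq_map => x /=; rewrite addnA. Qed.

Lemma shift_cat n s1 s2 : shift n (s1 ++ s2) = shift n s1 ++ shift n s2.
Proof. exact: map_cat. Qed.

Lemma dsumA : associative dsum.
Proof.
move=> u v w; rewrite /dsum shift_cat shiftD size_cat size_map catA.
by rewrite [size v + _]addnC.
Qed.

Lemma bars_cons a al : bars (a :: al) = dsum a (bars al).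
Proof.
rewrite /bars /dsum /= shift0 add0n; congr (_ ++ _).
rewrite -[in LHS](add0n (size a)); move: 0 (size a) => n m.
elim: al n => //= b al IH n; rewrite shift_cat shiftD; congr (_ ++ _).
by rewrite -IH addnAC.
Qed.

Lemma bars_cat al be : bars (al ++ be) = dsum (bars al) (bars be).
Proof.
elim: al => [|a al IH] /=; last by rewrite !bars_cons IH dsumA.
by rewrite /dsum /= shift0.
Qed.

Lemma bars_take_drop j al : bars al = dsum (bars (take j al)) (bars (drop j al)).
Proof. by rewrite -bars_cat cat_take_drop. Qed.

Lemma is_perm_uniq w : is_perm w -> uniq w.
Proof. by move=> /perm_uniq ->; apply: iota_uniq. Qed.

Lemma mem_is_perm w x : is_perm w -> (x \in w) = (0 < x <= size w).
Proof. by move=> /perm_mem ->; rewrite mem_iota add1n ltnS. Qed.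

Lemma shift_iota n m k : shift n (iota m k) = iota (m + n) k.
Proof.
by rewrite addnC iotaDl; apply: eq_map => x; rewrite addnC.
Qed.

Lemma is_perm_dsum u v : is_perm u -> is_perm v -> is_perm (dsum u v).
Proof.
rewrite /is_perm size_cat size_map iotaD => pu pv; apply: perm_cat => //.
by rewrite -shift_iota perm_map.
Qed.

Lemma is_perm_bars al : all complete al -> is_perm (bars al).
Proof.
elim: al => //= a al IH /andP[/and3P[pa _ _] /IH].
by rewrite bars_cons; apply: is_perm_dsum.
Qed.

Lemma dsum_lt u v : is_perm u -> is_perm v ->
  allrel (directed true) u (shift (size u) v).
Proof.
move=> pu pv; apply/allrelP => x z; rewrite (mem_is_perm _ pu).
move=> /andP[_ xu] /mapP[y]; rewrite (mem_is_perm _ pv) => /andP[y0 _ ->].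
by apply: leq_ltn_trans xu _; rewrite -[X in X < _]add0n ltn_add2r.
Qed.

(** Sorting both factors separately sorts the whole word, so the first factor
    collects the smallest values. *)
Lemma is_perm_low_factor q1 q2 : is_perm (q1 ++ q2) ->
  allrel ltn q1 q2 -> perm_eq q1 (iota 1 (size q1)).
Proof.
move=> p12 lt12.
have srt : sorted leq (sort leq q1 ++ sort leq q2).
  rewrite sorted_pairwise ?pairwise_cat; last exact: leq_trans.
  rewrite -!sorted_pairwise; try exact: leq_trans.
  rewrite !sort_sorted; try exact: leq_total.
  rewrite !andbT; apply/allrelP => x y; rewrite !mem_sort => xq yq.
  exact/ltnW/(allrelP lt12).
have : sort leq q1 ++ sort leq q2 = iota 1 (size (q1 ++ q2)).
  apply: (sorted_eq leq_trans anti_leq srt (iota_sorted _ _)).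
  by apply: perm_trans p12; apply: perm_cat; rewrite perm_sort.
move/(congr1 (take (size q1))).
rewrite take_size_cat ?size_sort // size_cat iotaD take_size_cat ?size_iota //.
by move=> <-; rewrite perm_sym perm_sort.
Qed.

(** A cut separating small values from large ones cannot fall inside a complete
    summand, where it would exhibit a proper initial segment made of
    1, ..., m. *)
Lemma bars_low_factor al q1 q2 : all complete al -> bars al = q1 ++ q2 ->
  allrel ltn q1 q2 -> exists2 j, j <= size al & q1 = bars (take j al).
Proof.
elim: al q1 q2 => [|a al IH] q1 q2 /=; first by case: q1 => // _ _ _; exists 0.
case/andP=> ca call; rewrite bars_cons /dsum => eq12 lt12.
have [->|q1_gt0] := eqVneq q1 [::]; first by exists 0.
have [pa _ /forallP compl] := and3P ca.
case: (ltnP (size q1) (size a)) => [lt1|le1].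
  have q1E : q1 = take (size q1) a.
    have := congr1 (take (size q1)) eq12.
    by rewrite (takel_cat _ (ltnW lt1)) take_size_cat.
  have q2E : q2 = drop (size q1) a ++ shift (size a) (bars al).
    have := congr1 (drop (size q1)) eq12.
    by rewrite drop_cat lt1 drop_size_cat.
  have /= := compl (Ordinal lt1); rewrite lt0n size_eq0 q1_gt0 /=.
  rewrite -q1E; case/negP; apply: (@is_perm_low_factor _ (drop (size q1) a)).
    by rewrite [in X in X ++ _]q1E cat_take_drop.
  by move: lt12; rewrite q2E allrel_catr => /andP[].
have q1E : q1 = a ++ drop (size a) q1.
  rewrite -[LHS](cat_take_drop (size a)); congr (_ ++ _).
  have := congr1 (take (size a)) eq12.
  by rewrite take_size_cat // takel_cat.
move: eq12; rewrite q1E -catA => /eqP; rewrite eqseq_cat // eqxx /= => /eqP.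
set r1 := drop _ _ in q1E * => eq12.
have [b1 [b2 [alE r1E q2E]]] : exists b1 b2, [/\ bars al = b1 ++ b2,
    r1 = shift (size a) b1 & q2 = shift (size a) b2].
  exists (take (size r1) (bars al)), (drop (size r1) (bars al)).
  split; first by rewrite cat_take_drop.
    by rewrite /shift map_take -/(shift _ _) eq12 take_size_cat.
  by rewrite /shift map_drop -/(shift _ _) eq12 drop_size_cat.
have [|j lej b1E] := IH _ _ call alE.
  move: lt12; rewrite q1E allrel_catl => /andP[_].
  rewrite r1E q2E allrel_mapl allrel_mapr.
  by under eq_allrel do rewrite /= ltn_add2r.
by exists j.+1; rewrite //= bars_cons /dsum -b1E r1E.
Qed.

(** A copy of a direct sum inside u | v splits along the two blocks, and
    it can only split between complete summands. *)
Lemma contains_dsum u v al : is_perm u -> is_perm v -> all complete al ->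
  reflect (exists2 j, j <= size al &
             contains u (bars (take j al)) && contains v (bars (drop j al)))
          (contains (dsum u v) (bars al)).
Proof.
move=> pu pv cal; apply: (iffP (contains_cat _ (dsum_lt pu pv))).
  case=> [[q1 q2] /= [eq12 lt12]]; rewrite contains_shiftl => h1 h2.
  have [j lej q1E] := bars_low_factor cal eq12 lt12.
  exists j => //; rewrite -q1E h1 /=; move: eq12.
  rewrite (bars_take_drop j) -q1E /dsum => /eqP.
  rewrite eqseq_cat // eqxx /= => /eqP q2E.
  by move: h2; rewrite -q2E contains_shiftr.
case=> j lej /andP[h1 h2].
exists (bars (take j al), shift (size (bars (take j al))) (bars (drop j al))).
split => //=; first exact: bars_take_drop.
  have cc : all complete (take j al ++ drop j al) by rewrite cat_take_drop.
  move: cc; rewrite all_cat => /andP[c1 c2].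
  by apply: dsum_lt; apply: is_perm_bars.
by rewrite contains_shift.
Qed.

(** * Caps and the overline operation *)

Definition cap (t : seq nat) : seq nat := (size t).+2 :: rcons (shift 1 t) 1.

Definition strip_max (p : seq nat) : seq nat :=
  if all (gtn (head 0 p)) (behead p) then behead p else p.

Definition strip_min (p : seq nat) : seq nat :=
  let q := take (size p).-1 p in if all (ltn (last 0 p)) q then q else p.

(** In a copy of p, an entry above and before all others can only be a
    leading maximum of p; the rest of the copy then lies in w. *)
Lemma contains_max_cons M w p : all (gtn M) w ->
  contains (M :: w) p = contains w (strip_max p).
Proof.
move=> Mw; rewrite -cat1s.
have cat := @contains_cat false [:: M] w; rewrite allrel1l in cat.
apply/(cat p Mw)/idP => [[[[|m [|m' q1]] q2] /= [-> lt12 c1 c2]]|].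
- rewrite /strip_max; case: ifP => // _; case: q2 {lt12} c2 => //= m q2.
  by rewrite -cat1s => /contains_factors/andP[].
- by move: lt12; rewrite allrel1l /strip_max /= => ->.
- by move: (contains_size c1).
rewrite /strip_max; case: ifP => [gt_p c|_ c]; last first.
  by exists ([::], p); rewrite /= c contains_nil.
case: p gt_p c => [|m q] /= gt_p c.
  by exists ([::], [::]); rewrite /= !contains_nil.
by exists ([:: m], q); rewrite /= allrel1l contains1.
Qed.

Lemma contains_rcons_min m w p : all (ltn m) w ->
  contains (rcons w m) p = contains w (strip_min p).
Proof.
move=> mw; rewrite -cats1.
have cat := @contains_cat false w [:: m]; rewrite allrel1r in cat.
have init (q : seq nat) y : take (size (rcons q y)).-1 (rcons q y) = q.
  by rewrite size_rcons -cats1 take_size_cat.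
apply/(cat p mw)/idP => [[[q1 q2] /= [-> lt12 c1 c2]]|].
  case: q2 => [|y [|y' q2]] in lt12 c2 *; last by have := contains_size c2.
    rewrite cats0 /strip_min; case: ifP => // _.
    case/lastP: q1 {lt12} c1 => // q1 y; rewrite init -cats1.
    by case/contains_factors/andP.
  move: lt12; rewrite allrel1r /= => lt12.
  by rewrite cats1 /strip_min init last_rcons ifT.
rewrite /strip_min; case: ifP => [lt_p c|_ c]; last first.
  exists (p, [::]); rewrite /= cats0 c contains_nil.
  by split=> //; exact: allrel0r.
case/lastP: p lt_p c => [|q y] /=.
  by move=> _ _; exists ([::], [::]); rewrite /= !contains_nil.
rewrite init last_rcons => lt_p c.
by exists (q, [:: y]); rewrite /= cats1 allrel1r contains1.
Qed.

(** The outer entries of a cap can only play the role of a leading maximum and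
    of a trailing minimum, which is exactly what the overline removes. *)
Lemma contains_cap t p : is_perm t -> is_perm p ->
  contains (cap t) p = contains t (overline p).
Proof.
move=> pt pp.
have tM x : x \in t -> 0 < x <= size t by rewrite mem_is_perm.
rewrite /cap contains_max_cons; last first.
  rewrite all_rcons /=; apply/allP => _ /mapP[x /tM/andP[_ xt] ->] /=.
  by rewrite addn1 ltnS.
rewrite contains_rcons_min; last first.
  apply/allP => _ /mapP[x /tM/andP[x0 _] ->] /=.
  by rewrite addn1.
case: p pp => [|a p] pp; first by rewrite !contains_nil.
case/lastP: p pp => [|s b] pp; first by rewrite !contains_nil.
have szp : size (a :: rcons s b) = (size s).+2 by rewrite /= size_rcons.
have up := is_perm_uniq pp; have mp x := mem_is_perm x pp.
move: up; rewrite /= rcons_uniq mem_rcons inE negb_or.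
case/and3P=> /andP[ab anis] bnis us.
rewrite szp in mp.
have predK r : all (leq 1) r ->
    contains t (map predn r) = contains (shift 1 t) r.
  move=> r0; rewrite contains_shiftl -(contains_shiftr 1 _ (map _ _)).
  rewrite /shift -map_comp map_id_in // => x /(allP r0) /=.
  by rewrite addn1; apply: prednK.
have s0 : all (leq 1) s.
  apply/allP => x xs; have := mp x; rewrite !inE mem_rcons inE xs !orbT.
  by case/esym/andP.
have a0 : 0 < a by have := mp a; rewrite inE eqxx => /esym/andP[].
have b0 : 0 < b.
  by have := mp b; rewrite !inE mem_rcons inE eqxx orbT => /esym/andP[].
have headE : (a == (size s).+2) = all (gtn a) (rcons s b).
  apply/eqP/allP => [aE x xsb|gta].
    have := mp x; rewrite inE xsb orbT -aE => /esym/andP[_].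
    rewrite leq_eqVlt => /predU1P[xa|//]; move: xsb.
    by rewrite xa mem_rcons inE (negPf ab) (negPf anis).
  apply/eqP; have := mp (size s).+2; rewrite leqnn inE => /orP[/eqP-> //|].
  move=> /gta /= lta; have := mp a; rewrite inE eqxx => /esym/andP[_].
  by rewrite leqNgt lta.
have lastE : (b == 1) = all (ltn b) (a :: s).
  apply/eqP/allP => [bE x xas|ltb].
    have /= := mp x; rewrite -rcons_cons mem_rcons inE xas orbT bE.
    case/esym/andP; rewrite leq_eqVlt => /predU1P[xb|//]; move: xas.
    by rewrite -xb -bE inE eq_sym (negPf ab) (negPf bnis).
  have := mp 1; rewrite -rcons_cons mem_rcons inE => /orP[/eqP //|/ltb /=].
  by rewrite ltnS leqNgt b0.
have lastE' : a = (size s).+2 -> (b == 1) = all (ltn b) s.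
  move=> aE; rewrite lastE /=; case: (ltnP b a) => //= ba.
  by have := mp b; rewrite !inE mem_rcons inE eqxx orbT /= leqNgt -aE; lia.
rewrite /overline szp /= last_rcons headE /strip_max /= -headE.
have init (q : seq nat) y : take (size (rcons q y)).-1 (rcons q y) = q.
  by rewrite size_rcons -cats1 take_size_cat.
case: eqP => [aE|_]; rewrite /strip_min.
  rewrite init last_rcons -lastE' //.
  case: eqP => _; last exact: contains_shiftl.
  by rewrite -predK // -cats1 take_size_cat.
rewrite -rcons_cons init last_rcons -lastE.
case: eqP => _; last exact: contains_shiftl.
by rewrite -predK /= ?a0 // -cats1 take_size_cat.
Qed.

Lemma complete3412 : complete [:: 3; 4; 1; 2].
Proof. by apply/and3P; split=> //; apply/forallP => -[[|[|[|[|]]]]]. Qed.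

Lemma avoids3412_dsum u v : is_perm u -> is_perm v ->
  avoids (dsum u v) [:: 3; 4; 1; 2] =
  avoids u [:: 3; 4; 1; 2] && avoids v [:: 3; 4; 1; 2].
Proof.
move=> pu pv; rewrite /avoids -negb_or; congr negb.
have c : all complete [:: [:: 3; 4; 1; 2]] by rewrite /= complete3412.
apply/(contains_dsum pu pv c)/orP => [[[|[|//]] _ /andP[]]|[]].
- by right.
- by left.
- by move=> cu; exists 1; rewrite //= contains_nil andbT.
- by move=> cv; exists 0; rewrite //= contains_nil.
Qed.

Lemma avoids3412_cap t : is_perm t ->
  avoids (cap t) [:: 3; 4; 1; 2] = avoids t [:: 3; 4; 1; 2].
Proof. by move=> pt; rewrite /avoids contains_cap. Qed.

(** * Involutions as words *)

(** Positions are numbered from 0 and values from 1, hence the predecessor and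
    the successor.  The bounds on the values make w a permutation. *)
Definition inv_word (w : seq nat) : bool :=
  all (fun i => (0 < nth 0 w i <= size w) && (nth 0 w (nth 0 w i).-1 == i.+1))
      (iota 0 (size w)).

Lemma inv_wordP w :
  reflect (forall i, i < size w -> 0 < nth 0 w i <= size w /\
                       nth 0 w (nth 0 w i).-1 = i.+1)
          (inv_word w).
Proof.
apply: (iffP allP) => h i; have := h i; rewrite mem_iota add0n /= => hi.
  by move=> /hi /andP[-> /eqP].
by move=> /hi [-> /eqP].
Qed.

Lemma is_perm_inv_word w : inv_word w -> is_perm w.
Proof.
move=> /inv_wordP iw.
have uw : uniq w.
  apply/(uniqP 0) => i j; rewrite !inE => /iw[_ iE] /iw[_ jE] ij.
  by apply: succn_inj; rewrite -iE -jE ij.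
have sub : {subset w <= iota 1 (size w)}.
  move=> x /(nthP 0)[i /iw[+ _] <-].
  by rewrite mem_iota add1n ltnS.
have [|_ mem_w] := uniq_min_size uw sub; first by rewrite size_iota.
exact: uniq_perm uw (iota_uniq _ _) mem_w.
Qed.

Lemma nth_shift n s i : i < size s -> nth 0 (shift n s) i = nth 0 s i + n.
Proof. exact: nth_map. Qed.

Lemma nth_dsum u v i : nth 0 (dsum u v) i =
  if i < size u then nth 0 u i
  else if i < size u + size v then nth 0 v (i - size u) + size u else 0.
Proof.
rewrite /dsum nth_cat; case: ltnP => // ui.
case: (ltnP i) => iv; first by rewrite nth_shift // ltn_subLR.
by rewrite nth_default // size_map leq_subRL.
Qed.

Lemma nth_cap t i : nth 0 (cap t) i.+1 =
  if i < size t then (nth 0 t i).+1 else (i == size t).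
Proof.
rewrite /cap /= nth_rcons size_map; case: ltnP => it.
  by rewrite nth_shift // addn1.
by case: eqP.
Qed.

Lemma size_dsum u v : size (dsum u v) = size u + size v.
Proof. by rewrite size_cat size_map. Qed.

Lemma size_cap t : size (cap t) = (size t).+2.
Proof. by rewrite /= size_rcons size_map. Qed.

Lemma inv_word_dsum u v : inv_word u -> inv_word v -> inv_word (dsum u v).
Proof.
move=> /inv_wordP iu /inv_wordP iv; apply/inv_wordP => i.
rewrite size_dsum [nth 0 (dsum u v) i]nth_dsum nth_dsum.
case: (ltnP i (size u)) => [ui _|ui ilt].
  have [/andP[x0 xu] xi] := iu _ ui.
  have xu' : (nth 0 u i).-1 < size u by rewrite prednK.
  by rewrite xu' x0 xi (leq_trans xu) ?leq_addr.
have iv' : i - size u < size v by rewrite ltn_subLR.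
have [/andP[x0 xv] xi] := iv _ iv'; rewrite ilt.
have xE : (nth 0 v (i - size u) + size u).-1 =
    size u + (nth 0 v (i - size u)).-1.
  by rewrite addnC -{1}(prednK x0) addnS.
rewrite xE [size u + _ < size u]ltnNge leq_addr /= ltn_add2l prednK // xv.
by rewrite addKn xi addSn subnK // ltn_addr // addnC leq_add2l.
Qed.

Lemma inv_word_cap t : inv_word t -> inv_word (cap t).
Proof.
move=> /inv_wordP it; apply/inv_wordP => -[_|i].
  rewrite size_cap /= -[nth 0 _ _]/(nth 0 (cap t) (size t).+1) nth_cap.
  by rewrite ltnn eqxx leqnn.
rewrite size_cap !ltnS nth_cap => ilt; case: (ltnP i (size t)) => [it'|ti].
  have [/andP[x0 xt] xi] := it _ it'.
  split; first exact: leqW.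
  by rewrite [_.+1.-1]/= -(prednK x0) nth_cap prednK // xt xi.
have -> : i = size t by apply/eqP; rewrite eqn_leq ilt.
by rewrite eqxx.
Qed.

(** A set of positions {0,...,k-1} stable under an involution has a stable
    complement, so the word splits there. *)
Lemma inv_word_split w k : inv_word w -> k <= size w ->
  (forall i, i < k -> nth 0 w i <= k) ->
  exists u v, [/\ w = dsum u v, size u = k, inv_word u & inv_word v].
Proof.
move=> /inv_wordP iw kw low.
have high i : k <= i -> i < size w -> k < nth 0 w i.
  move=> ki /iw[/andP[x0 _] xi]; rewrite ltnNge; apply/negP => xk.
  have := low (nth 0 w i).-1; rewrite xi prednK // => /(_ xk).
  by rewrite leqNgt ltnS ki.
have szu : size (take k w) = k by rewrite size_takel.
have szv : size w = k + size (drop k w) by rewrite size_drop subnKC.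
exists (take k w), (map (subn^~ k) (drop k w)); split => //.
- rewrite /dsum szu /shift -map_comp map_id_in ?cat_take_drop // => x.
  case/(nthP 0) => i; rewrite size_drop ltn_subRL => ilt <- /=.
  by rewrite nth_drop subnK // ltnW // high ?leq_addr.
- apply/inv_wordP => i; rewrite szu => ik.
  have [/andP[x0 _] xi] := iw _ (leq_trans ik kw).
  by rewrite !nth_take ?prednK ?low // x0.
apply/inv_wordP => i; rewrite size_map => iv.
have iw' : k + i < size w by rewrite szv ltn_add2l.
have [/andP[x0 xw] xi] := iw _ iw'.
have kx := high _ (leq_addr _ _) iw'.
rewrite (nth_map 0) // nth_drop subn_gt0 kx leq_subLR -szv xw; split=> //.
have eqx : k + (nth 0 w (k + i) - k).-1 = (nth 0 w (k + i)).-1.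
  by move: (nth 0 w (k + i)) kx => x kx; lia.
rewrite (nth_map 0); last by rewrite -(ltn_add2l k) eqx -szv prednK.
by rewrite nth_drop eqx xi -addnS addKn.
Qed.

(** Exchanging 1 with the maximal value confines the other positions to the
    values strictly in between. *)
Lemma inv_word_uncap u m : inv_word u -> size u = m.+2 -> nth 0 u 0 = m.+2 ->
  exists2 t, u = cap t & inv_word t.
Proof.
move=> iu szu u0; have pu := is_perm_inv_word iu.
have uu := is_perm_uniq pu; move/inv_wordP in iu.
have um : nth 0 u m.+1 = 1.
  by have := iu 0; rewrite szu u0 => /(_ isT) [_].
have mid i : i < m -> 1 < nth 0 u i.+1 < m.+2.
  move=> im; have i1 : i.+1 < size u by rewrite szu !ltnS ltnW.
  have [/andP[x0 xu] _] := iu _ i1; rewrite szu in i1.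
  have x1 : nth 0 u i.+1 != 1 by rewrite -um nth_uniq ?szu // eqSS ltn_eqF.
  have xm : nth 0 u i.+1 != m.+2 by rewrite -[X in _ != X]u0 nth_uniq ?szu.
  by rewrite [_ < m.+2]ltn_neqAle xm /=-szu xu andbT ltn_neqAle eq_sym x1.
have szm : size (take m (behead u)) = m.
  by rewrite size_takel // size_behead szu.
have nb i : i < m -> nth 0 (take m (behead u)) i = nth 0 u i.+1.
  by move=> im; rewrite nth_take // nth_behead.
have uE : u = m.+2 :: rcons (take m (behead u)) 1.
  apply: (@eq_from_nth _ 0) => [|[|i]]; rewrite ?szu //=.
    by rewrite size_rcons szm.
  rewrite nth_rcons szm !ltnS => ilt; case: (ltnP i m) => [/nb-> //|mi].
  have -> : i = m by apply/eqP; rewrite eqn_leq mi ilt.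
  by rewrite eqxx.
exists (map predn (take m (behead u))).
  rewrite {1}uE /cap size_map szm /shift -map_comp map_id_in // => x.
  case/(nthP 0) => i; rewrite szm => /[dup] im /mid /andP[x1 _].
  by rewrite nb // => <- /=; rewrite addn1 prednK // ltnW.
apply/inv_wordP => i; rewrite size_map szm => im.
have := mid i im; have [|_] := iu i.+1; first by rewrite szu !ltnS ltnW.
rewrite (nth_map 0) ?szm // nb //.
case: (nth 0 u i.+1) => [|[|y]] //= xi ym; split=> //.
by rewrite (nth_map 0) ?szm // nb // xi.
Qed.

(** * The first block of a 3412-avoiding involution *)

Lemma subseq_nth (w s : seq nat) : sorted ltn s -> all (gtn (size w)) s ->
  subseq [seq nth 0 w i | i <- s] w.
Proof.
move=> srt lt_s; rewrite -[X in subseq _ X](mkseq_nth 0 w) map_subseq //.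
have -> : s = [seq i <- iota 0 (size w) | i \in s].
  apply: (irr_sorted_eq ltn_trans ltnn) => //.
    exact/(sorted_filter ltn_trans)/iota_ltn_sorted.
  move=> x; rewrite mem_filter mem_iota add0n /=.
  by case xs: (x \in s) => //=; apply: esym; exact: allP lt_s x xs.
exact: filter_subseq.
Qed.

(** If some i < j = w(1) had w(i) > j, then w would contain the 3412-pattern
    j w(i) 1 i, read at the positions 1 < i < j < w(i). *)
Lemma inv3412_low w i : inv_word w -> avoids w [:: 3; 4; 1; 2] ->
  i < nth 0 w 0 -> nth 0 w i <= nth 0 w 0.
Proof.
move=> /inv_wordP iw; set j := nth 0 w 0 => av ij; rewrite leqNgt.
apply/negP => jv; case/negP: av.
have w0 : 0 < size w by case: (w) @j ij jv.
have [/andP[j0 jw] wj] := iw 0 w0; rewrite -/j in j0 jw wj.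
have [/andP[v0 vw] wv] := iw i (leq_trans ij jw).
set v := nth 0 w i in jv v0 vw wv.
have i0 : 0 < i by rewrite lt0n; apply/eqP => i0; rewrite /v i0 ltnn in jv.
have ij1 : i < j.-1.
  rewrite -ltnS prednK // ltn_neqAle ij andbT; apply/eqP => iE.
  by move: wj jv; rewrite -iE /= -/v => ->.
have jv1 : j.-1 < v.-1 by rewrite -ltnS !prednK.
apply/containsP; exists [seq nth 0 w l | l <- [:: 0; i; j.-1; v.-1]].
  apply: subseq_nth; rewrite /= ?i0 ?ij1 ?jv1 ?w0 ?(leq_trans ij jw) //.
  by rewrite !prednK // jw vw.
rewrite same_order_zip /= wj wv -/j -/v /allrel /= /cmp_agree /=.
by move: (j) (v) i0 ij1 jv => a b i0 ij1 jv; lia.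
Qed.

(** The first value j closes the block {1, ..., j}; unless j = 1, the block
    begins with its maximum and therefore ends with 1. *)
Lemma inv3412_cases w : inv_word w -> avoids w [:: 3; 4; 1; 2] -> w != [::] ->
  exists u v, [/\ w = dsum u v, inv_word v &
    u = [:: 1] \/ exists2 t, u = cap t & inv_word t].
Proof.
move=> iw av; rewrite -size_eq0 -lt0n => w0.
have [/andP[j0 jw] _] := elimT (inv_wordP w) iw 0 w0.
have low i := @inv3412_low w i iw av.
have [u [v [wE szu iu iv]]] := inv_word_split iw jw low.
exists u, v; split=> //.
have u0 : nth 0 u 0 = nth 0 w 0 by rewrite wE nth_dsum szu j0.
case jE : (nth 0 w 0) => [|[|m]] in j0 u0 szu *; [by []|left|right].
  by case: u szu u0 {wE iu} => [|x [|]] //= _ ->.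
exact: inv_word_uncap iu szu u0.
Qed.

(** The one-line words of the 3412-avoiding involutions, as a list, so that the
    recursive structure is a permutation of lists and sums can be reindexed
    along it. *)
Definition words n : seq (seq nat) :=
  [seq one_line s | s <- enum [set s : 'S_n |
     (s * s == 1)%g && avoids (one_line s) [:: 3; 4; 1; 2]]].

Lemma size_one_line n (s : 'S_n) : size (one_line s) = n.
Proof. by rewrite size_map size_enum_ord. Qed.

Lemma nth_one_line n (s : 'S_n) (i : 'I_n) : nth 0 (one_line s) i = (s i).+1.
Proof. by rewrite (nth_map i) ?size_enum_ord // nth_ord_enum. Qed.

Lemma one_line_inj n : injective (@one_line n).
Proof.
move=> s s' E; apply/permP => i; apply/val_inj/succn_inj.
by rewrite -!nth_one_line E.
Qed.

Lemma inv_word_one_line n (s : 'S_n) : inv_word (one_line s) = (s * s == 1)%g.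
Proof.
apply/inv_wordP/eqP=> [h|s2 i]; last rewrite size_one_line => ilt.
  rewrite size_one_line in h; apply/permP => i; have [_] := h i (ltn_ord i).
  rewrite !nth_one_line /= => -[sE].
  by apply: val_inj; rewrite permM perm1.
rewrite -[i]/(val (Ordinal ilt)) !nth_one_line /= ltn_ord; split=> //.
by rewrite -permM s2 perm1.
Qed.

Lemma one_line_surj w : inv_word w -> exists s : 'S_(size w), one_line s = w.
Proof.
move=> /inv_wordP iw.
have lt_f (i : 'I_(size w)) : (nth 0 w i).-1 < size w.
  by have [/andP[x0 xw] _] := iw i (ltn_ord i); rewrite prednK.
have f_inj : injective (fun i => Ordinal (lt_f i)).
  move=> i j [ij]; apply/val_inj/succn_inj => /=.
  have [_ <-] := iw i (ltn_ord i); have [_ <-] := iw j (ltn_ord j).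
  by rewrite ij.
exists (perm f_inj).
apply: (@eq_from_nth _ 0); rewrite size_one_line // => i ilt.
rewrite -[in LHS]/(nat_of_ord (Ordinal ilt)) nth_one_line permE /=.
by have [/andP[x0 _] _] := iw i ilt; rewrite prednK.
Qed.

Lemma mem_words n w : (w \in words n) =
  [&& size w == n, inv_word w & avoids w [:: 3; 4; 1; 2]].
Proof.
apply/mapP/and3P => [[s]|[/eqP <- iw av]].
  rewrite mem_enum inE => /andP[s2 av] ->.
  by rewrite size_one_line eqxx inv_word_one_line.
have [s sE] := one_line_surj iw; exists s => //.
by rewrite mem_enum inE -inv_word_one_line sE iw.
Qed.

Lemma uniq_words n : uniq (words n).
Proof. by rewrite map_inj_uniq ?enum_uniq //; apply: one_line_inj. Qed.

Definition capped_words n : seq (seq nat) :=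
  [seq dsum (cap tv.1) tv.2 | a <- iota 0 n,
     tv <- [seq (t, v) | t <- words a, v <- words (n - a.+1)]].

Lemma mem_capped_words n w : reflect
  (exists a t v, [/\ a < n, t \in words a, v \in words (n - a.+1) &
                     w = dsum (cap t) v])
  (w \in capped_words n).
Proof.
apply: (iffP allpairsPdep) => [[a [[t v] [+ /allpairsP[tv ht] ->]]]|].
  by case: tv ht => t' v' /= [ht hv [-> ->]]; rewrite mem_iota => an;
    exists a, t', v'.
case=> a [t [v [an ht hv ->]]]; exists a, (t, v); split=> //.
  by rewrite mem_iota.
by apply/allpairsP; exists (t, v).
Qed.

Lemma dsum_cap_inj t v t' v' :
  dsum (cap t) v = dsum (cap t') v' -> t = t' /\ v = v'.
Proof.
have shift_inj k : injective (shift k) by apply: inj_map; apply: addIn.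
move=> E; have [szt _] := E; move/eqP: E.
rewrite eqseq_cat; last by rewrite !size_cap szt.
rewrite !size_cap szt => /andP[/eqP[_ /rcons_inj[/shift_inj->]]].
by move=> /eqP/shift_inj->.
Qed.

Lemma uniq_capped_words n : uniq (capped_words n).
Proof.
apply: allpairs_uniq_dep => [|a _|]; first exact: iota_uniq.
  by apply: allpairs_uniq; rewrite ?uniq_words // => -[? ?] [? ?].
move=> p p' /allpairsPdep[a [[t v] [_ /allpairsP[[t1 v1] /= [ht _ [-> _]]] ->]]].
case/allpairsPdep=> a' [[t' v'] [_ /allpairsP[[t2 v2] /= [ht' _ [-> _]]] ->]].
move=> /= /dsum_cap_inj[tE ->].
move: ht ht'; rewrite !mem_words tE => /andP[/eqP <- _] /andP[/eqP <- _].
by [].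
Qed.

Lemma inv1 : inv_word [:: 1]. Proof. by []. Qed.

(** A word of the class splits after its first block, and summing or capping
    creates no new copy of 3412, a complete pattern equal to its own overline.
    The first value tells the two lists apart. *)
Lemma words_succ n :
  perm_eq (words n.+1) ([seq dsum [:: 1] v | v <- words n] ++ capped_words n).
Proof.
apply: uniq_perm; first exact: uniq_words.
  rewrite cat_uniq uniq_capped_words andbT map_inj_uniq ?uniq_words /=.
    2: by move=> v v' [] /(inj_map (@addIn 1)).
  apply/hasPn => _ /mem_capped_words[a [t [v [_ _ _ ->]]]].
  by apply/mapP => -[].
move=> w; rewrite mem_cat; apply/idP/orP.
  rewrite mem_words => /and3P[/eqP szw iw av].
  have w0 : w != [::] by rewrite -size_eq0 szw.
  have [u [v [wE iv uE]]] := inv3412_cases iw av w0.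
  move: szw av; rewrite wE size_dsum; case: uE => [->|[t -> it]].
    rewrite avoids3412_dsum ?is_perm_inv_word // => -[szv] /andP[_ av].
    by left; rewrite map_f // mem_words -szv eqxx iv.
  rewrite size_cap => -[sz].
  have [pt pv] := (is_perm_inv_word it, is_perm_inv_word iv).
  rewrite avoids3412_dsum ?is_perm_inv_word ?inv_word_cap //.
  rewrite avoids3412_cap // => /andP[avt avv].
  right; apply/mem_capped_words; exists (size t), t, v; split=> //.
  - by rewrite -sz addSn ltnS leq_addr.
  - by rewrite mem_words eqxx it.
  - by rewrite mem_words -sz addSn subSS addKn eqxx iv.
case=> [/mapP[v + ->]|/mem_capped_words[a [t [v [an + + ->]]]]].
  rewrite !mem_words size_dsum => /and3P[/eqP-> iv av].
  rewrite eqxx inv_word_dsum ?inv1 // avoids3412_dsum ?is_perm_inv_word //.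
  by rewrite av andbT; apply/negP => /contains_size.
rewrite !mem_words => /and3P[/eqP szt it avt] /and3P[/eqP szv iv avv].
rewrite size_dsum size_cap szt szv addSn subnKC // eqxx.
rewrite inv_word_dsum ?inv_word_cap //.
rewrite avoids3412_dsum ?is_perm_inv_word ?inv_word_cap //.
by rewrite avoids3412_cap ?is_perm_inv_word // avt.
Qed.

(** * Greedy splitting along a direct sum *)

Lemma avoids_take u i al : avoids u (bars (take i al)) ->
  avoids u (bars (take i.+1 al)).
Proof.
apply: contra; rewrite (bars_take_drop i) take_takel //.
by case/contains_factors/andP.
Qed.

Lemma avoids_drop v i al : avoids v (bars (drop i.+1 al)) ->
  avoids v (bars (drop i al)).
Proof.
apply: contra; rewrite (bars_take_drop 1) drop_drop add1n.
by case/contains_factors/andP=> _; rewrite contains_shiftr.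
Qed.

(** The block 1 can host the first factor only, and only if that factor is 1;
    hosting it is then never a loss. *)
Lemma avoids_dsum1 v al : is_perm v -> all complete al -> al != [::] ->
  avoids (dsum [:: 1] v) (bars al) =
  avoids v (if nth [::] al 0 == [:: 1] then bars (behead al) else bars al).
Proof.
move=> pv cal; case: al cal => // a al cal _ /=; congr negb.
have [pa a0 _] := and3P (proj1 (andP cal)).
apply/(contains_dsum (is_perm_inv_word inv1) pv cal)/idP => [[[|j] /= _]|c].
- rewrite contains_nil; case: eqP => // _.
  by rewrite bars_cons => /contains_factors/andP[_]; rewrite contains_shiftr.
- rewrite bars_cons => /andP[/contains_size]; rewrite size_dsum /= => sz cv.
  have sza : size a = 1.
    by apply/eqP; rewrite eqn_leq a0 (leq_trans _ sz) ?leq_addr.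
  have -> : a = [:: 1].
    case: a sza pa {a0 cal sz} => [|x [|]] //= _ /perm_mem /(_ x).
    by rewrite !inE eqxx => /esym/eqP ->.
  rewrite eqxx (bars_take_drop j).
  move: sz; rewrite sza -[X in _ <= X]addn0 leq_add2l leqn0 size_eq0 => /eqP ->.
  by rewrite /dsum contains_shiftr.
move: c; case: eqP => [->|_] c; last by exists 0; rewrite //= contains_nil.
by exists 1; rewrite //= take0 drop0 c andbT /bars /= contains1.
Qed.

(** * Generating functions *)

Section PowerSeries.
Import GRing.Theory.
Local Open Scope ring_scope.

(** Only the step where a switches from false to true contributes, and its
    term is the value of b just before; as b is decreasing, that value
    decides the conjunction of all a i || b i. *)
Lemma telescope_indicator (a b : nat -> bool) k :
  a 0%N = false -> (forall i, a i -> a i.+1) -> (forall i, b i.+1 -> b i) ->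
  \sum_(i < k) ((a i.+1)%:R - (a i)%:R) * (b i)%:R =
  (a k && all (fun i => a i || b i) (iota 0 k))%:R :> int.
Proof.
move=> a0 a_mono b_anti.
have b_le i j : (i <= j)%N -> b j -> b i.
  by move/subnK <-; elim: (j - i)%N => //= d IH /b_anti /IH.
have a_le i j : (i <= j)%N -> a i -> a j.
  by move/subnK <-; elim: (j - i)%N => //= d IH /IH /a_mono.
elim: k => [|k IH]; first by rewrite big_ord0 a0.
have -> : iota 0 k.+1 = iota 0 k ++ [:: k] by rewrite -addn1 iotaD.
rewrite big_ord_recr /= {}IH all_cat /= andbT.
case ak: (a k) => /=; first by rewrite (a_mono _ ak) subrr mul0r addr0 andbT.
rewrite add0r subr0 -natrM mulnb; congr ((_ && _)%:R).
case bk: (b k); rewrite ?andbF //= andbT; apply/esym/allP => i.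
by rewrite mem_iota => ik; rewrite (b_le _ k) ?orbT // ltnW.
Qed.

(** The only index that contributes is the first i such that u avoids the
    first i factors; the part of a copy left for v then includes at least
    the factors from the i-th on, and can be taken to be exactly those. *)
Lemma avoids_dsum u v al : is_perm u -> is_perm v -> all complete al ->
  (avoids (dsum u v) (bars al))%:R =
  \sum_(i < size al)
    ((avoids u (bars (take i.+1 al)))%:R - (avoids u (bars (take i al)))%:R) *
    (avoids v (bars (drop i al)))%:R :> int.
Proof.
move=> pu pv cal.
rewrite (telescope_indicator (a := fun i => avoids u (bars (take i al)))
                             (b := fun i => avoids v (bars (drop i al)))).
- congr (_%:R : int); congr nat_of_bool; rewrite take_size.
  apply/idP/andP => [|[au /allP h]].
    move/(contains_dsum pu pv cal) => h; split.
      apply/negP => c; apply: h; exists (size al) => //.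
      by rewrite take_size c drop_size contains_nil.
    apply/allP => i; rewrite mem_iota => /ltnW ik.
    by rewrite /avoids -negb_and; apply/negP => c; apply: h; exists i.
  apply/negP => /(contains_dsum pu pv cal)[i].
  rewrite leq_eqVlt => /predU1P[->|ik].
    by rewrite take_size (negPf au).
  by have := h i; rewrite mem_iota -negb_and => /(_ ik)/negP.
- by rewrite take0 /avoids contains_nil.
- by move=> i; apply: avoids_take.
- by move=> i; apply: avoids_drop.
Qed.

Lemma coefF sigma n :
  coef (F sigma) n = \sum_(w <- words n) (avoids w sigma)%:R.
Proof.
rewrite /= big_map big_enum_cond /= -natz -sum1_card natr_sum.
rewrite big_mkcond [RHS]big_mkcond; apply: eq_bigr => s _.
by rewrite !inE andbA; case: ((_ == _) && _); case: avoids.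
Qed.

Lemma coefXM0 f : coef ('x * f) 0 = 0.
Proof. by rewrite Defs.coefM big_ord1 /= mul0r. Qed.

Lemma coefXMS f n : coef ('x * f) n.+1 = coef f n.
Proof.
rewrite Defs.coefM 2!big_ord_recl /= mul0r add0r mul1r subSS subn0.
rewrite big1 ?addr0 //.
by move=> i _; rewrite mul0r.
Qed.

Lemma coef_fps_sum I (r : seq I) (f : I -> fps) n :
  coef (\sum_(i <- r) f i) n = \sum_(i <- r) coef (f i) n.
Proof. by apply: (big_morph (fun g => coef g n)) => [g h|]. Qed.

Lemma coef_fpsB (f g : fps) n : coef (f - g) n = coef f n - coef g n.
Proof. by []. Qed.

Lemma sum_capped_words n al : all complete al ->
  \sum_(w <- capped_words n) (avoids w (bars al))%:R =
  \sum_(i < size al) \sum_(a < n)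
    coef (F (overline (bars (take i.+1 al))) - F (overline (bars (take i al)))) a
    * coef (F (bars (drop i al))) (n - a.+1) :> int.
Proof.
move=> cal; rewrite big_allpairs_dep -[n in iota 0 n]subn0.
rewrite -/(index_iota 0 n) big_mkord [RHS]exchange_big; apply: eq_bigr => a _.
rewrite big_allpairs_dep.
transitivity (\sum_(t <- words a) \sum_(i < size al)
    \sum_(v <- words (n - a.+1))
      ((avoids t (overline (bars (take i.+1 al))))%:R -
       (avoids t (overline (bars (take i al))))%:R) *
      (avoids v (bars (drop i al)))%:R : int).
  apply: eq_big_seq => t; rewrite mem_words => /and3P[_ it _].
  rewrite exchange_big; apply: eq_big_seq => v.
  rewrite mem_words => /and3P[_ iv _] /=.
  have pt := is_perm_inv_word it.
  rewrite avoids_dsum ?is_perm_inv_word ?inv_word_cap //.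
  have pal j : is_perm (bars (take j al)).
    apply: is_perm_bars; apply/allP => x /mem_take; exact: (allP cal).
  by apply: eq_bigr => i _; rewrite /avoids !contains_cap.
rewrite exchange_big; apply: eq_bigr => i _.
rewrite coef_fpsB !coefF -sumrB mulr_suml; apply: eq_bigr => t _.
by rewrite mulr_sumr.
Qed.

End PowerSeries.

Theorem corollary5p6 (pi : seq nat) (alpha : seq (seq nat)) (beta : seq nat)
    (pi_perm : is_perm pi) (pi_nonempty : pi != [::])
    (alpha_complete : all complete alpha)
    (pi_def : pi = bars alpha)
    (beta_def :
       beta = if nth [::] alpha 0 == [:: 1] then bars (behead alpha) else pi) :
  (F pi = 1 + 'x * F beta +
     'x ^+ 2 * \sum_(1 <= i < (size alpha).+1)
       (F (overline (bars (take i alpha))) -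
        F (overline (bars (take i.-1 alpha)))) *
       F (bars (drop i.-1 alpha)))%R.
Proof.
have al0 : alpha != [::].
  by apply: contraNneq pi_nonempty => al0; rewrite pi_def al0.
apply/fpsP => -[|n]; rewrite !Defs.coefD GRing.expr2 -GRing.mulrA ?coefXM0 ?coefXMS.
  (* In degree 0 the only word is the empty one, which avoids pi. *)
  rewrite !GRing.addr0 coefF (perm_big [:: [::]]).
    rewrite big_seq1 /avoids; case: (boolP (contains _ _)) => // /contains_size.
    by rewrite leqn0 size_eq0 (negPf pi_nonempty).
  apply: uniq_perm; rewrite ?uniq_words // => w.
  rewrite mem_words inE size_eq0; case: eqP => // -> /=.
  by apply/negP => /contains_size.
rewrite coefF (perm_big _ (words_succ n)) big_cat big_map GRing.add0r.
congr (_ + _)%R.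
  rewrite coefF; apply: eq_big_seq => v; rewrite mem_words => /and3P[_ iv _].
  by rewrite pi_def avoids_dsum1 ?is_perm_inv_word // beta_def pi_def.
rewrite pi_def sum_capped_words // big_add1 big_mkord.
(* For n = 0 there is no room for a cap, and the factor x^2 vanishes. *)
case: n => [|n]; first by rewrite coefXM0 big1 // => i _; rewrite big_ord0.
rewrite coefXMS coef_fps_sum; apply: eq_bigr => i _; rewrite Defs.coefM.
by apply: eq_bigr.
Qed.
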